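(* Let $k\ge 3$ and let $p_1\ge p_2\ge\cdots\ge p_k\ge 1$ and $q_1\ge q_2\ge\cdots\ge q_k\ge 1$ be two different $k$-tuples of integers with $\sum_{i=1}^k p_i=\sum_{i=1}^k q_i$. Then the complete $k$-partite graphs $K_{p_1,\ldots,p_k}$ and $K_{q_1,\ldots,q_k}$ are not switching equivalent.
   Context: All graphs are finite and simple. For a partition $V(G)=U\cup W$ of the vertex set of a graph $G$, Seidel switching with respect to $U$ produces the graph on the same vertex set obtained by deleting all edges between $U$ and $W$ and adding an edge between $u\in U$ and $w\in W$ whenever $uw$ was not an edge of $G$ (edges inside $U$ and inside $W$ are unchanged). Two graphs are switching equivalent if one is obtained from the other by a Seidel switching. *)

(* Defs.v *)
From mathcomp Require Import all_boot.

Set Implicit Arguments.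
Unset Strict Implicit.
Unset Printing Implicit Defensive.

Record sgraph (T : finType) := SGraph {
  adj : rel T;
  adj_sym : symmetric adj;
  adj_irrefl : irreflexive adj
}.

Section Switching.
Variable T : finType.
Implicit Types (G : sgraph T) (U : {set T}).

(* The second class of the partition is W = ~: U; U or W may be empty. *)
Definition switch_rel G U : rel T :=
  fun x y => if (x \in U) == (y \in U) then adj G x y else ~~ adj G x y.

Lemma switch_sym G U : symmetric (switch_rel G U).
Proof. by move=> x y; rewrite /switch_rel eq_sym adj_sym. Qed.

Lemma switch_irrefl G U : irreflexive (switch_rel G U).
Proof. by move=> x; rewrite /switch_rel eqxx adj_irrefl. Qed.

Definition switch G U : sgraph T := SGraph (@switch_sym G U) (@switch_irrefl G U).

End Switching.

Definition graph_iso (T T' : finType) (G : sgraph T) (H : sgraph T') : Prop :=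
  exists2 f : T -> T', bijective f & forall x y, adj H (f x) (f y) = adj G x y.

(* Graphs are considered up to isomorphism, so that the notion makes sense
   for graphs with different vertex types. *)
Definition switching_equivalent (T T' : finType) (G : sgraph T) (H : sgraph T')
  : Prop := exists U : {set T}, graph_iso (switch G U) H.

Section CompleteMultipartite.
Variables (k : nat) (p : k.-tuple nat).

(* Vertex (i, a) is the a-th vertex of the i-th part, of size tnth p i. *)
Definition multipartite_vertex : finType := {i : 'I_k & 'I_(tnth p i)}.

Definition multipartite_rel : rel multipartite_vertex :=
  fun x y => tag x != tag y.

Lemma multipartite_sym : symmetric multipartite_rel.
Proof. by move=> x y; rewrite /multipartite_rel eq_sym. Qed.

Lemma multipartite_irrefl : irreflexive multipartite_rel.
Proof. by move=> x; rewrite /multipartite_rel eqxx. Qed.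

Definition complete_multipartite : sgraph multipartite_vertex :=
  SGraph multipartite_sym multipartite_irrefl.

End CompleteMultipartite.

(* Main.v *)
Require Import Defs.
From mathcomp Require Import all_boot.

Set Implicit Arguments.
Unset Strict Implicit.
Unset Printing Implicit Defensive.

(** Non-adjacency is transitive in a complete multipartite graph, hence in any
    graph isomorphic to one.  If it is transitive after switching [G] with
    respect to [U], then every triangle of [G] lies on one side of [U]: a vertex
    separated from the two others would become non-adjacent to both, while these
    two stay adjacent.  In a complete multipartite graph with at least three
    parts, any two vertices have a common neighbour, so that every edge lies in
    a triangle and the graph is connected.  Hence [U] is empty or full and
    switching changes nothing, whereas isomorphic complete multipartite graphs
    have the same part sizes up to order. *)

Lemma exists_notin (T : finType) (s : seq T) :
  size s < #|T| -> exists x, x \notin s.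
Proof.
move=> s_small; have /subsetPn[x _ xs] : ~~ (T \subset s).
  apply: contraL s_small => /subset_leq_card T_le_s.
  by rewrite -leqNgt (leq_trans T_le_s) ?card_size.
by exists x.
Qed.

Lemma card_tagged_with (I : finType) (T_ : I -> finType) (i : I) :
  #|tagged_with T_ i| = #|T_ i|.
Proof. by rewrite -card_sig -(bij_eq_card (tag_with_bij T_ i)). Qed.

Lemma sorted_tnth (T : Type) (r : rel T) (k : nat) (t : k.-tuple T) :
  (forall i j : 'I_k, i <= j -> r (tnth t i) (tnth t j)) -> sorted r t.
Proof.
move=> t_mono; rewrite -[tval t]map_tnth_enum.
apply: (homo_sorted (e := relpre val leq)) => [i j|]; first exact: t_mono.
by rewrite -sorted_map val_enum_ord iota_sorted.
Qed.

Lemma sorted_geq_eq (s t : seq nat) :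
  sorted geq s -> sorted geq t -> perm_eq s t -> s = t.
Proof.
apply: sorted_eq => [|m n]; first exact: rev_trans leq_trans.
by rewrite andbC => /anti_leq.
Qed.

Definition nonadj (T : finType) (G : sgraph T) : rel T :=
  fun x y => ~~ adj G x y.

Lemma graph_iso_nonadj_trans (T T' : finType) (G : sgraph T) (H : sgraph T') :
  graph_iso G H -> transitive (nonadj H) -> transitive (nonadj G).
Proof.
move=> [f _ f_adj] H_trans y x z.
by rewrite /nonadj -!f_adj; apply: H_trans.
Qed.

Lemma eq_graph_iso (T T' : finType) (G G' : sgraph T) (H : sgraph T') :
  adj G =2 adj G' -> graph_iso G H -> graph_iso G' H.
Proof. by move=> eqG [f f_bij f_adj]; exists f => // x y; rewrite f_adj. Qed.

Section SwitchingTriangles.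
Variables (T : finType) (G : sgraph T) (U : {set T}).

Lemma adj_switch x y :
  adj G x y -> adj (switch G U) x y = ((x \in U) == (y \in U)).
Proof. by move=> xy; rewrite /= /switch_rel xy; case: eqP. Qed.

Lemma switch_closed_connected :
  (forall x y, connect (adj G) x y) -> closed (adj G) U ->
  adj (switch G U) =2 adj G.
Proof.
move=> G_conn U_closed x y; rewrite /= /switch_rel.
by rewrite (closed_connect U_closed (G_conn x y)) eqxx.
Qed.

Hypothesis switch_nonadj_trans : transitive (nonadj (switch G U)).

Lemma triangle_same_side x y z :
  adj G x y -> adj G x z -> adj G y z -> (x \in U) = (y \in U).
Proof.
move=> xy xz yz; have yx : adj G y x by rewrite adj_sym.
have := @switch_nonadj_trans x y z; have := @switch_nonadj_trans y x z.
rewrite /nonadj !adj_switch //.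
by case: (x \in U); case: (y \in U); case: (z \in U) => // via_y via_x;
  do [have := via_y isT isT | have := via_x isT isT].
Qed.

Lemma switch_common_neighbor_trivial :
  (forall x y, exists2 z, adj G x z & adj G y z) ->
  adj (switch G U) =2 adj G.
Proof.
move=> common_neighbor; apply: switch_closed_connected => x y.
  have [z xz yz] := common_neighbor x y.
  by apply: (connect_trans (y := z)); apply: connect1; rewrite // adj_sym.
move=> xy; have [z xz yz] := common_neighbor x y.
exact: triangle_same_side yz.
Qed.

End SwitchingTriangles.

Section PartRepresentatives.
Variables (k : nat) (p : k.-tuple nat).
Hypothesis p_pos : forall i : 'I_k, 0 < tnth p i.

Definition part_repr (i : 'I_k) : multipartite_vertex p :=
  Tagged _ (Ordinal (p_pos i)).

Lemma multipartite_common_neighbor (x y : multipartite_vertex p) : 2 < k ->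
  exists2 z, adj (complete_multipartite p) x z
           & adj (complete_multipartite p) y z.
Proof.
move=> k_gt2; have [i] : exists i, i \notin [:: tag x; tag y].
  by apply: exists_notin; rewrite card_ord.
rewrite !inE negb_or => /andP[ix iy].
by exists (part_repr i); rewrite /= /multipartite_rel eq_sym.
Qed.

End PartRepresentatives.

Lemma multipartite_nonadj_trans (k : nat) (p : k.-tuple nat) :
  transitive (nonadj (complete_multipartite p)).
Proof.
by move=> y x z; rewrite /nonadj /= /multipartite_rel !negbK => /eqP->.
Qed.

Lemma card_multipartite_part (k : nat) (p : k.-tuple nat) (i : 'I_k) :
  #|[pred x : multipartite_vertex p | tag x == i]| = tnth p i.
Proof. exact: etrans (card_tagged_with _ i) (card_ord _). Qed.

Lemma multipartite_iso_perm_eq (k k' : nat) (p : k.-tuple nat)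
    (q : k'.-tuple nat) :
  (forall i, 0 < tnth p i) -> (forall j, 0 < tnth q j) ->
  graph_iso (complete_multipartite p) (complete_multipartite q) ->
  perm_eq p q.
Proof.
move=> p_pos q_pos [f f_bij f_adj].
have eq_tag_f x y : (tag (f x) == tag (f y)) = (tag x == tag y).
  exact/negb_inj/f_adj.
pose part_map i := tag (f (part_repr p_pos i)).
have tag_f x : tag (f x) = part_map (tag x) by apply/eqP; rewrite eq_tag_f.
have part_map_inj : injective part_map.
  by move=> i j /eqP; rewrite eq_tag_f => /eqP.
have part_map_surj j : exists i, part_map i = j.
  have [g _ fK] := f_bij.
  by exists (tag (g (part_repr q_pos j))); rewrite -tag_f fK.
have part_map_size i : tnth q (part_map i) = tnth p i.
  rewrite -!card_multipartite_part.
  rewrite -(on_card_preimset (f := f)); last exact: onW_bij.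
  by apply: eq_card => x; rewrite !inE eq_tag_f.
rewrite -[tval p]map_tnth_enum -[tval q]map_tnth_enum.
rewrite -(eq_map part_map_size) map_comp; apply/perm_map/uniq_perm.
- by rewrite map_inj_uniq ?enum_uniq.
- exact: enum_uniq.
- move=> j; have [i <-] := part_map_surj j.
  by rewrite mem_enum map_f // mem_enum.
Qed.

Theorem theorem3p4 (k : nat) (p q : k.-tuple nat)
  (hk : 3 <= k)
  (p_decr : forall i j : 'I_k, i <= j -> tnth p j <= tnth p i)
  (p_pos : forall i : 'I_k, 1 <= tnth p i)
  (q_decr : forall i j : 'I_k, i <= j -> tnth q j <= tnth q i)
  (q_pos : forall i : 'I_k, 1 <= tnth q i)
  (p_neq_q : p <> q)
  (sum_eq : \sum_(i < k) tnth p i = \sum_(i < k) tnth q i) :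
  ~ switching_equivalent (complete_multipartite p) (complete_multipartite q).
Proof.
move=> [U switch_iso]; apply/p_neq_q/val_inj.
have switch_nonadj_trans :
    transitive (nonadj (switch (complete_multipartite p) U)).
  exact: graph_iso_nonadj_trans switch_iso (@multipartite_nonadj_trans _ q).
have switch_trivial :
    adj (switch (complete_multipartite p) U) =2 adj (complete_multipartite p).
  apply: switch_common_neighbor_trivial switch_nonadj_trans _ => x y.
  exact: multipartite_common_neighbor.
have p_iso_q := eq_graph_iso switch_trivial switch_iso.
apply: sorted_geq_eq (multipartite_iso_perm_eq p_pos q_pos p_iso_q).
- exact: sorted_tnth p_decr.
- exact: sorted_tnth q_decr.
Qed.
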